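(* Let $n\ge2$ and let $a=\sum_{\alpha\in I(\mathbb{KP}_n)}a_\alpha\chi_\alpha\in C(\mathbb{KP}_n)$ (with $a_\alpha\in\mathbb C$) be such that $\mathcal F(a)$ is a state. If the random walk $(\mathcal F(a)^{\star k})_{k\in\mathbb N}$ converges, then its limit state $\mu$ is a central idempotent state.
   Context: Sekine quantum group $\mathbb{KP}_n$ ($n\ge2$). Put $\eta=e^{2\imath\pi/n}$; all indices are taken modulo $n$. $C(\mathbb{KP}_n)=\bigoplus_{i,j\in\mathbb Z_n}\mathbb C e_{(i,j)}\oplus M_n(\mathbb C)$ as a $*$-algebra, where the $e_{(i,j)}$ are the units of the one-dimensional summands and $E_{i,j}$ ($1\le i,j\le n$) are matrix units of $M_n(\mathbb C)$. The coproduct is $\Delta(e_{(i,j)})=\sum_{s,t\in\mathbb Z_n}e_{(s,t)}\otimes e_{(i-s,j-t)}+\frac1n\sum_{m,r=1}^n\eta^{i(m-r)}E_{m,r}\otimes E_{m+j,r+j}$, $\Delta(E_{i,j})=\sum_{s,t\in\mathbb Z_n}\eta^{s(i-j)}e_{(-s,-t)}\otimes E_{i-t,j-t}+\sum_{s,t\in\mathbb Z_n}\eta^{s(j-i)}E_{i-t,j-t}\otimes e_{(s,t)}$. The Haar state is $\int_{\mathbb{KP}_n}\big(\sum x_{(i,j)}e_{(i,j)}+\sum X_{i,j}E_{i,j}\big)=\frac1{2n^2}\big(\sum_{i,j}x_{(i,j)}+n\sum_iX_{i,i}\big)$. For $x\in C(\mathbb{KP}_n)$, $\mathcal F(x)$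 is the linear functional $y\mapsto\int_{\mathbb{KP}_n}yx$. The convolution of functionals is $\phi\star\psi=(\phi\otimes\psi)\circ\Delta$, and $\phi^{\star k}$ is the $k$-fold convolution power. A state is a positive unital linear functional. A central idempotent state is a state $\phi$ on $C(\mathbb{KP}_n)$ such that $\phi\star\phi=\phi$ and $\phi\star\psi=\psi\star\phi$ for every linear functional $\psi$ on $C(\mathbb{KP}_n)$. Convergence is in the finite-dimensional dual space of $C(\mathbb{KP}_n)$. Irreducible representations: $I(\mathbb{KP}_n)$ is the set of (classes of) irreducible representations, $d_\alpha$ is the dimension and $\chi_\alpha$ the character of $\alpha$. It consists of the one-dimensional $\rho_l^\pm=\sum_{i,j}\eta^{il}e_{(i,j)}\pm\sum_{m=1}^nE_{m,m+l}$ ($l\in\mathbb Z_n$; $\rho_0^+$ is the unit), the two-dimensional $\mathfrak X^{u,v}$ ($u\in\mathbb Z_n$, $1\le v\le\lfloor\frac{n-1}2\rfloor$) with characters $2\sum_{s,t\in\mathbb Z_n}\eta^{su}\cos(\frac{2tv\pi}n)e_{(s,t)}$, and, if $n$ is even, also the one-dimensional $\sigma_l^\pm=\sum_{i,j}(-1)^j\eta^{il}e_{(i,j)}\pm\sum_{m=1}^n(-1)^mE_{m,m+l}$ ($l\in\mathbb Z_n$). *)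

(* Defs.v *)
From HB Require Import structures.
From mathcomp Require Import all_boot all_order all_algebra.
From mathcomp Require Import complex ring.
From mathcomp Require Import all_classical all_reals all_analysis.

Set Implicit Arguments.
Unset Strict Implicit.
Unset Printing Implicit Defensive.

Import Order.TTheory GRing.Theory Num.Theory.
Import numFieldNormedType.Exports.

Local Open Scope ring_scope.

(* All indices live in 'Z_n, which is Z/nZ only for n >= 2; matrices are
   indexed by the same type, so that E_(n,n) is E_(0,0) here. *)
Notation MZ R n := ('M[R[i]]_((Zp_trunc n).+2)) (only parsing).

(* The algebra C(KP_n): the ring structure is the library's one, pointwise on
   the first component and the matrix product on the second. *)
Notation CKP R n := ({ffun 'Z_n * 'Z_n -> R[i]} * MZ R n)%type.

(* Labels of the linear basis of C(KP_n) made of the e_(i,j) (inl) and of the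
   matrix units E_(i,j) (inr). *)
Notation bidx n := (('Z_n * 'Z_n) + ('Z_n * 'Z_n))%type.

(* C(KP_n) (x) C(KP_n), given by coordinates in the tensor product basis. *)
Notation CKP2 R n := {ffun bidx n * bidx n -> R[i]}.

Section Sekine.
Variables (R : realType) (n : nat).
Local Notation C := R[i].
Local Notation A := (CKP R n).
Local Notation A2 := (CKP2 R n).

Definition eta : C := (cos (2 * pi / n%:R) +i* sin (2 * pi / n%:R))%C.

(* eta ^ k for k modulo n *)
Definition etaX (k : 'Z_n) : C := eta ^+ (k : nat).

Definition e_ (i j : 'Z_n) : A := ([ffun p => (p == (i, j))%:R], 0).
Definition E_ (i j : 'Z_n) : A := (0, delta_mx i j).

Definition bas (b : bidx n) : A :=
  match b with inl p => e_ p.1 p.2 | inr p => E_ p.1 p.2 end.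

Definition bcoord (x : A) (b : bidx n) : C :=
  match b with inl p => x.1 p | inr p => x.2 p.1 p.2 end.

Definition star (x : A) : A :=
  ([ffun p => Num.conj (x.1 p)], (map_mx Num.conj x.2)^T).

Definition tens (x y : A) : A2 := [ffun p => bcoord x p.1 * bcoord y p.2].

Definition tensf (phi psi : {scalar A}) (t : A2) : C :=
  \sum_(p : bidx n * bidx n) t p * (phi (bas p.1) * psi (bas p.2)).

Definition Delta_e (i j : 'Z_n) : A2 :=
  \sum_(s : 'Z_n) \sum_(t : 'Z_n) tens (e_ s t) (e_ (i - s) (j - t))
  + n%:R^-1 *: \sum_(m : 'Z_n) \sum_(r : 'Z_n)
      etaX (i * (m - r)) *: tens (E_ m r) (E_ (m + j) (r + j)).

Definition Delta_E (i j : 'Z_n) : A2 :=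
  \sum_(s : 'Z_n) \sum_(t : 'Z_n)
     etaX (s * (i - j)) *: tens (e_ (- s) (- t)) (E_ (i - t) (j - t))
  + \sum_(s : 'Z_n) \sum_(t : 'Z_n)
     etaX (s * (j - i)) *: tens (E_ (i - t) (j - t)) (e_ s t).

Definition Delta (x : A) : A2 :=
  \sum_(i : 'Z_n) \sum_(j : 'Z_n) x.1 (i, j) *: Delta_e i j
  + \sum_(i : 'Z_n) \sum_(j : 'Z_n) x.2 i j *: Delta_E i j.

Definition haar (x : A) : C :=
  (2 * n%:R ^+ 2)^-1 *
    (\sum_(i : 'Z_n) \sum_(j : 'Z_n) x.1 (i, j)
     + n%:R * \sum_(i : 'Z_n) x.2 i i).

Definition fourier (x : A) : A -> C := fun y => haar (y * x).

Definition conv (phi psi : {scalar A}) : A -> C :=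
  fun x => tensf phi psi (Delta x).

Lemma bas_decomp (x : A) : x = \sum_b bcoord x b *: bas b.
Proof.
rewrite big_sumType /=; case: x => f M /=.
rewrite [RHS]surjective_pairing; congr (_, _).
- rewrite raddfD !raddf_sum /= [X in _ + X]big1 ?addr0; last first.
    by move=> p _; rewrite scaler0.
  apply/ffunP => p; rewrite sum_ffunE (bigD1 p) //= big1 ?addr0.
    by rewrite !ffunE -surjective_pairing eqxx [RHS]mulr1.
  move=> q qp; rewrite !ffunE -surjective_pairing eq_sym (negPf qp).
  exact: mulr0.
- rewrite raddfD !raddf_sum /= big1 ?add0r; last first.
    by move=> p _; rewrite scaler0.
  by rewrite [LHS]matrix_sum_delta pair_big /=.
Qed.

(* tensf phi psi is indeed phi (x) psi *)
Lemma tensf_tens (phi psi : {scalar A}) (x y : A) :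
  tensf phi psi (tens x y) = phi x * psi y.
Proof.
rewrite {2}(bas_decomp x) {2}(bas_decomp y) !raddf_sum /= mulr_suml.
rewrite /tensf.
under [RHS]eq_bigr do rewrite mulr_sumr.
rewrite pair_bigA /=; apply: eq_bigr => p _.
by rewrite !linearZ /= ffunE mulrACA.
Qed.

Lemma haar_scalar : scalar haar.
Proof.
move=> k x y; rewrite /haar.
have -> : \sum_i \sum_j (k *: x + y).1 (i, j) =
   k * (\sum_i \sum_j x.1 (i, j)) + \sum_i \sum_j y.1 (i, j).
  rewrite mulr_sumr -big_split; apply: eq_bigr => i _ /=.
  rewrite mulr_sumr -big_split; apply: eq_bigr => j _ /=.
  by rewrite !ffunE.
have -> : \sum_i (k *: x + y).2 i i = k * (\sum_i x.2 i i) + \sum_i y.2 i i.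
  rewrite mulr_sumr -big_split; apply: eq_bigr => i _ /=.
  by rewrite !mxE.
move: (_^-1) => c; ring.
Qed.

HB.instance Definition _ := GRing.isLinear.Build C A C *%R haar haar_scalar.

Lemma fourier_scalar (x : A) : scalar (fourier x).
Proof.
move=> k y z; rewrite /fourier mulrDl.
have -> : (k *: y) * x = k *: (y * x).
  congr (_, _); last exact: esym (scalemxAl _ _ _).
  by apply/ffunP => p; rewrite !ffunE; exact: esym (mulrA _ _ _).
exact: linearP.
Qed.

HB.instance Definition _ (x : A) :=
  GRing.isLinear.Build C A C *%R (fourier x) (fourier_scalar x).

Lemma conv_scalar (phi psi : {scalar A}) : scalar (conv phi psi).
Proof.
move=> k x y; rewrite /conv.
have -> : Delta (k *: x + y) = k *: Delta x + Delta y.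
  rewrite /Delta scalerDr addrACA; congr (_ + _);
  rewrite scaler_sumr -big_split;
  apply: eq_bigr => i _ /=; rewrite scaler_sumr -big_split;
  apply: eq_bigr => j _ /=.
  - by rewrite !ffunE scalerDl scalerA.
  - by rewrite !mxE scalerDl scalerA.
rewrite /tensf mulr_sumr -big_split; apply: eq_bigr => p _ /=.
by rewrite !ffunE mulrDl; congr (_ + _); exact: esym (mulrA _ _ _).
Qed.

HB.instance Definition _ (phi psi : {scalar A}) :=
  GRing.isLinear.Build C A C *%R (conv phi psi) (conv_scalar phi psi).

(* The (k+1)-st convolution power of phi; the shift avoids the power 0 and
   does not affect convergence. *)
Fixpoint convpowS (phi : {scalar A}) (k : nat) : {scalar A} :=
  if k is k'.+1 then conv (convpowS phi k') phi else phi.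

(* Convergence in the dual space, which is finite-dimensional, so that its
   topology is that of pointwise convergence. R[i]^o is R[i] with the topology
   of its norm. *)
Definition dual_cvg (f : nat -> {scalar A}) (mu : {scalar A}) : Prop :=
  forall x : A,
    ((fun k => f k x : C^o) @ \oo --> (mu x : C^o))%classic.

(* In R[i], 0 <= z means that z is real and nonnegative. *)
Definition is_state (phi : {scalar A}) : Prop :=
  (forall x : A, 0 <= phi (star x * x)) /\ phi 1 = 1.

Definition central_idempotent_state (phi : {scalar A}) : Prop :=
  [/\ is_state phi,
      conv phi phi =1 phi
    & forall psi : {scalar A}, conv phi psi =1 conv psi phi].

End Sekine.

(* The classes of irreducible representations; the boolean is the sign, true
   standing for -, and irrX u v is X^(u, v+1). *)
Inductive irr (n : nat) : Type :=
| irr_rho of bool & 'Z_n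
| irr_X of 'Z_n & 'I_(n.-1)./2
| irr_sigma of ~~ odd n & bool & 'Z_n.

Section Irr.
Variable n : nat.

Let code : Type := ((bool * 'Z_n) + ('Z_n * 'I_(n.-1)./2)
  + {_ : bool * 'Z_n | ~~ odd n})%type.

Definition irr_encode (a : irr n) : code :=
  match a with
  | irr_rho s l => inl (inl (s, l))
  | irr_X u v => inl (inr (u, v))
  | irr_sigma ev s l => inr (exist _ (s, l) ev)
  end.

Definition irr_decode (c : code) : irr n :=
  match c with
  | inl (inl (s, l)) => irr_rho s l
  | inl (inr (u, v)) => irr_X u v
  | inr (exist (s, l) ev) => irr_sigma ev s l
  end.

Lemma irr_encodeK : cancel irr_encode irr_decode.
Proof. by case. Qed.

HB.instance Definition _ := Finite.copy (irr n) (can_type irr_encodeK).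

End Irr.

Section Characters.
Variables (R : realType) (n : nat).

(* One-dimensional representations are their own characters. The exponents
   of -1 in chi (irr_sigma _ _ _) are well defined modulo n as n is even. *)
Definition chi (a : irr n) : CKP R n :=
  match a with
  | irr_rho s l =>
      \sum_(i : 'Z_n) \sum_(j : 'Z_n) etaX R (i * l) *: e_ R i j
      + (-1) ^+ s *: \sum_(m : 'Z_n) E_ R m (m + l)
  | irr_X u v =>
      2 *: \sum_(s : 'Z_n) \sum_(t : 'Z_n)
        (etaX R (s * u)
          * (cos (2 * (t : nat)%:R * (v.+1)%:R * pi / n%:R))%:C%C)
        *: e_ R s t
  | irr_sigma _ s l =>
      \sum_(i : 'Z_n) \sum_(j : 'Z_n)
        ((-1) ^+ (j : nat) * etaX R (i * l)) *: e_ R i j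
      + (-1) ^+ s *: \sum_(m : 'Z_n) (-1) ^+ (m : nat) *: E_ R m (m + l)
  end.

End Characters.

(* Main.v *)
(* Convolution turns the dual of C(KP_n) into a direct sum of n copies of the
   group algebra of the dihedral group of order 2n: Fourier transform in the
   first index of the e_(i,j), and sort the E_(i,j) by i - j. Hence convolution
   is associative, and a functional whose components are class functions is
   central, which is the case of [fourier chi] for every character [chi].
   Convolution preserves states by the Schur product theorem. If the powers of
   a central state [phi] converge to [mu], then mu * phi = mu, so
   mu * phi^k = mu for all k and mu * mu = mu in the limit; positivity and
   centrality also pass to the limit. *)
Require Import Defs.
From HB Require Import structures.
From mathcomp Require Import all_boot all_order all_algebra.
From mathcomp Require Import complex ring.
From mathcomp Require Import all_classical all_reals all_analysis.
Set Implicit Arguments.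
Unset Strict Implicit.
Unset Printing Implicit Defensive.
Import Defs Order.TTheory GRing.Theory Num.Theory.
Import numFieldNormedType.Exports.
Local Open Scope ring_scope.
Local Open Scope sesquilinear_scope.

(** * Powers of a primitive n-th root of unity and their orthogonality *)

Section RootOfUnity.
Variables (R : realType) (n : nat).
Hypothesis n_gt1 : (1 < n)%N.
Local Notation etaX := (etaX R).

Lemma eta_exp k : eta R n ^+ k =
  (cos (k%:R * (2 * pi / n%:R)) +i* sin (k%:R * (2 * pi / n%:R)))%C.
Proof.
elim: k => [|k IH]; first by rewrite expr0 mul0r cos0 sin0.
rewrite exprS IH /eta; set t := 2 * pi / n%:R.
rewrite -add1n natrD mulrDl mul1r cosD sinD.
by congr (_ +i* _)%C; rewrite ?[sin _ * cos _ + _]addrC.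
Qed.

(** If the k-th power is 1 with 0 < k < n, the double angle formula gives sin (k pi / n) = 0,
    whereas k pi / n lies strictly between 0 and pi. *)
Lemma eta_prim : n.-primitive_root (eta R n).
Proof.
have n0 : (n%:R : R) != 0 by rewrite pnatr_eq0 -lt0n (ltn_trans _ n_gt1).
have np : (0 < n%:R :> R) by rewrite ltr0n (ltn_trans _ n_gt1).
apply/andP; split; first exact: ltn_trans n_gt1.
apply/forallP => i; apply/eqP.
rewrite unity_rootE eta_exp.
have [-> | iN] := eqVneq i.+1 n.
  rewrite mulrC mulfVK // mulr_natl cos2pi sin2pi; exact: eqxx.
apply/negbTE; apply/eqP => -[+ _].
have -> : i.+1%:R * (2 * pi / n%:R) = (i.+1%:R / n%:R * pi) *+ 2 :> R.
  by rewrite -mulr_natl; ring.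
rewrite cos_mulr2n cos2sin2 => h.
have : 0 < sin (i.+1%:R / n%:R * pi : R).
  apply: sin_gt0_pi; apply/andP; split.
    by rewrite !mulr_gt0 ?invr_gt0 ?pi_gt0 ?np.
  rewrite gtr_pMl ?pi_gt0 // ltr_pdivrMr // mul1r ltr_nat.
  by rewrite ltn_neqAle iN ltn_ord.
have -> : sin (i.+1%:R / n%:R * pi : R) = 0; last by rewrite ltxx.
apply/eqP; rewrite -sqrf_eq0; apply/eqP.
move: h; set x := sin _ ^+ 2 => h.
have : (1 - x) *+ 2 - 1 - 1 = 0 by rewrite h subrr.
rewrite mulrnBl -addrA addrC -[- 1 - 1]opprD -mulr2n addrA addNr add0r.
by move=> /eqP; rewrite oppr_eq0 mulrn_eq0 /= => /eqP.
Qed.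

Lemma etaX_natmod (k : nat) (x : 'Z_n) : (k = x %[mod n])%N ->
  eta R n ^+ k = etaX x.
Proof. by move=> e; rewrite -(prim_expr_mod eta_prim) e (prim_expr_mod eta_prim). Qed.

Lemma etaX0 : etaX (0 : 'Z_n) = 1.
Proof. exact: expr0. Qed.

Lemma etaXD (x y : 'Z_n) : etaX (x + y) = etaX x * etaX y.
Proof.
have modZp a : (a = a %% (Zp_trunc n).+2 %[mod n])%N.
  by rewrite Zp_cast // modn_mod.
by rewrite /etaX -exprD; apply/esym/etaX_natmod; exact: modZp.
Qed.

Lemma etaXN_mul (x : 'Z_n) : etaX x * etaX (- x) = 1.
Proof. by rewrite -etaXD subrr etaX0. Qed.

Lemma conj_etaX (x : 'Z_n) : (etaX x)^* = etaX (- x).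
Proof.
have e0 : etaX x != 0.
  by apply/eqP => e0; have /eqP := etaXN_mul x; rewrite e0 mul0r eq_sym oner_eq0.
apply: (mulfI e0); rewrite etaXN_mul.
rewrite /etaX eta_exp.
set t := _ * _; apply/eqP; rewrite eq_complex /=.
by rewrite mulrN opprK -!expr2 cos2Dsin2 mulrN mulrC addNr !eqxx.
Qed.

(** Shifting s by 1 multiplies the sum by [etaX d], which differs from 1 unless d = 0. *)
Lemma sum_etaX (d : 'Z_n) :
  \sum_(s : 'Z_n) etaX (s * d) = if d == 0 then n%:R else 0.
Proof.
case: eqP => [->|/eqP d0].
  under eq_bigr do rewrite mulr0 etaX0.
  by rewrite sumr_const card_ord Zp_cast.
apply/eqP; have : (etaX d - 1) * \sum_(s : 'Z_n) etaX (s * d) = 0.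
  rewrite mulrBl mul1r mulr_sumr [X in _ - X](reindex_inj (addrI 1)) /=.
  apply/eqP; rewrite subr_eq0; apply/eqP; apply: eq_bigr => s _.
  by rewrite -etaXD mulrDl mul1r.
move/eqP; rewrite mulf_eq0 => /orP[|//]; rewrite subr_eq0 /etaX.
rewrite -(prim_order_dvd eta_prim) => /dvdnP[q dq].
have : (d < n)%N by rewrite -[X in (_ < X)%N](Zp_cast n_gt1).
rewrite dq; case: q dq => [dq _|q _]; last by rewrite mulSn ltnNge leq_addr.
by move: d0; rewrite -val_eqE /= dq.
Qed.

End RootOfUnity.

(** * Positive semidefinite matrices and the Schur product theorem *)

Section PositiveMatrices.
Variables (C : numClosedFieldType) (m : nat).
Implicit Types M N : 'I_m -> 'I_m -> C.

(** Here [0 <=] includes being real, and Hermitian symmetry follows from that. *)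
Definition psd M : Prop :=
  forall c : 'I_m -> C, 0 <= \sum_i \sum_j (c i)^* * c j * M i j.

(** Polarization: varying z at the vector with entry 1 at i and z at j gives access to the
    off-diagonal entries. *)
Lemma quad_form_supp2 M (i j : 'I_m) (z : C) : i != j ->
  \sum_k \sum_l ((k == i)%:R + (k == j)%:R * z)^*
      * ((l == i)%:R + (l == j)%:R * z) * M k l
  = M i i + z * M i j + z^* * M j i + z^* * z * M j j.
Proof.
move=> ij.
have sum2 (F : 'I_m -> C) (w : C) :
    \sum_k ((k == i)%:R + (k == j)%:R * w) * F k = F i + w * F j.
  rewrite (bigD1 i) //= eqxx (negPf ij) mul0r addr0 mul1r; congr (_ + _).
  have ji : j != i by rewrite eq_sym.
  rewrite (bigD1 j ji) /= eqxx (negPf ji) add0r mul1r.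
  rewrite big1 ?addr0 // => k /andP[ki kj].
  by rewrite (negPf ki) (negPf kj) mul0r addr0 mul0r.
transitivity (\sum_k ((k == i)%:R + (k == j)%:R * z^*) * (M k i + z * M k j)).
  apply: eq_bigr => k _; rewrite -sum2 mulr_sumr; apply: eq_bigr => l _.
  by rewrite rmorphD rmorphM /= !conjC_nat mulrA.
by rewrite sum2 mulrDr !addrA mulrA.
Qed.

(** The difference [H] of M and its adjoint has an identically zero form. Unit vectors kill its
    diagonal; polarization with z = 1 and z = ['i] kills the rest. *)
Lemma psd_hermitian M : psd M -> forall i j, M j i = (M i j)^*.
Proof.
move=> hM i j.
pose H k l := M k l - (M l k)^*.
have H0 (c : 'I_m -> C) : \sum_k \sum_l (c k)^* * c l * H k l = 0.
  set q := \sum_k \sum_l (c k)^* * c l * M k l.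
  rewrite (_ : \sum_k _ = q - q^*); first by rewrite (geC0_conj (hM c)) subrr.
  have -> : q^* = \sum_k \sum_l (c l * (c k)^* * (M l k)^*).
    rewrite exchange_big /q raddf_sum /=; apply: eq_bigr => k _.
    rewrite raddf_sum /=; apply: eq_bigr => l _.
    by rewrite !rmorphM /= conjCK.
  rewrite -sumrB; apply: eq_bigr => k _.
  rewrite -sumrB; apply: eq_bigr => l _.
  by rewrite mulrBr [c l * _]mulrC.
have diag k : H k k = 0.
  rewrite -[RHS](H0 (fun l => (l == k)%:R)) (bigD1 k) //=.
  rewrite [X in _ + X]big1 ?addr0; last first.
    move=> l /negPf lk; apply: big1 => p _.
    by rewrite lk conjC0 !mul0r.
  rewrite (bigD1 k) //= big1 ?addr0; last first.
    by move=> l /negPf ->; rewrite mulr0 mul0r.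
  by rewrite eqxx conjC1 !mul1r.
have [-> | ij] := eqVneq i j.
  by apply/eqP; rewrite -subr_eq0 -/(H j j) diag.
have e z : z * H i j + z^* * H j i = 0.
  have := quad_form_supp2 H z ij; rewrite !diag H0 mulr0 addr0 add0r.
  by move=> <-.
have := e 1; have := e 'i.
rewrite conjC1 !mul1r conjCi mulNr -mulrBr => /eqP.
rewrite mulf_eq0 (negPf (neq0Ci _)) /= subr_eq0 => /eqP ->.
rewrite -mulr2n => /eqP; rewrite mulrn_eq0 /= subr_eq0 => /eqP; exact.
Qed.

(** By the spectral theorem, with [P] a diagonalizing unitary matrix and [d] the eigenvalues. *)
Lemma psd_gram M : psd M ->
  exists (d : 'I_m -> C) (P : 'M[C]_m), (forall k, 0 <= d k) /\
    forall i j, M i j = \sum_k d k * (P k i)^* * P k j.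
Proof.
move=> hM; pose A := \matrix_(i, j) M i j.
have An : A \is normalmx.
  apply: hermitian_normalmx; apply/is_hermitianmxP.
  rewrite expr0 scale1r; apply/matrixP => i j; rewrite !mxE.
  exact: psd_hermitian.
have /orthomx_spectralP := An.
set P := spectralmx A; set d := spectral_diag A => eA.
have uP : P \is unitarymx := spectral_unitarymx A.
rewrite (invmx_unitary uP) in eA.
exists (fun k => d 0 k), P; split=> [k | i j]; last first.
  transitivity (A i j); first by rewrite mxE.
  rewrite {1}eA mxE; apply: eq_bigr => k _.
  by rewrite mul_mx_diag !mxE [_ * d 0 k]mulrC.
have -> : d 0 k = (P *m A *m P ^t*) k k.
  rewrite eA !mulmxA (unitarymxP uP) mul1mx -mulmxA (unitarymxP uP) mulmx1.
  by rewrite mxE eqxx mulr1n.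
(* The k-th eigenvalue is the value of the form at the conjugated k-th row of [P]. *)
have := hM (fun i => (P k i)^*).
congr (0 <= _); rewrite mxE exchange_big; apply: eq_bigr => j _.
rewrite mxE mulr_suml; apply: eq_bigr => i _.
by rewrite conjCK !mxE mulrAC.
Qed.

(** Expanding M alone in Gram form turns the form of the entrywise product at c into a nonnegative
    combination of values of the form of N, at the vectors with entries [c i * P k i]. *)
Lemma psd_schur M N : psd M -> psd N -> psd (fun i j => M i j * N i j).
Proof.
move=> /psd_gram[d [P [d0 eM]]] hN c.
suff -> : \sum_i \sum_j (c i)^* * c j * (M i j * N i j) =
  \sum_k d k * \sum_i \sum_j (c i * P k i)^* * (c j * P k j) * N i j.
  by apply: sumr_ge0 => k _; apply: mulr_ge0.
under [RHS]eq_bigr do rewrite mulr_sumr.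
rewrite [RHS]exchange_big; apply: eq_bigr => i _.
under [RHS]eq_bigr do rewrite mulr_sumr.
rewrite [RHS]exchange_big; apply: eq_bigr => j _.
rewrite eM mulr_suml mulr_sumr; apply: eq_bigr => k _.
by rewrite rmorphM /=; ring.
Qed.

Lemma psdD M N : psd M -> psd N -> psd (fun i j => M i j + N i j).
Proof.
move=> hM hN c; have := addr_ge0 (hM c) (hN c); congr (0 <= _).
rewrite -big_split; apply: eq_bigr => i _ /=.
by rewrite -big_split; apply: eq_bigr => j _ /=; rewrite mulrDr.
Qed.

Lemma psd_sum (I : finType) (M : I -> 'I_m -> 'I_m -> C) :
  (forall k, psd (M k)) -> psd (fun i j => \sum_k M k i j).
Proof.
move=> hM c; rewrite (_ : \sum_i _ =
  \sum_k \sum_i \sum_j (c i)^* * c j * M k i j).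
  by apply: sumr_ge0 => k _; apply: hM.
rewrite [RHS]exchange_big; apply: eq_bigr => i _.
rewrite [RHS]exchange_big; apply: eq_bigr => j _.
by rewrite mulr_sumr.
Qed.

Lemma psdZ a M : 0 <= a -> psd M -> psd (fun i j => a * M i j).
Proof.
move=> a0 hM c; have := mulr_ge0 a0 (hM c); congr (0 <= _).
rewrite mulr_sumr; apply: eq_bigr => i _.
by rewrite mulr_sumr; apply: eq_bigr => j _; rewrite mulrCA.
Qed.

(** The factor [u] is absorbed into the test vector. *)
Lemma psd_rank1_mul u M : psd M -> psd (fun i j => u i * (u j)^* * M i j).
Proof.
move=> hM c; have := hM (fun i => (u i)^* * c i); congr (0 <= _).
apply: eq_bigr => i _; apply: eq_bigr => j _.
by rewrite rmorphM /= conjCK; ring.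
Qed.

Lemma psd_reindex (f : 'I_m -> 'I_m) M :
  injective f -> psd M -> psd (fun i j => M (f i) (f j)).
Proof.
move=> f_inj hM c; have := hM (fun i => c (invF f_inj i)); congr (0 <= _).
rewrite (reindex_inj f_inj); apply: eq_bigr => i _ /=.
rewrite (reindex_inj f_inj); apply: eq_bigr => j _ /=.
by rewrite !invF_f.
Qed.
End PositiveMatrices.

(** * The dihedral group of order 2n and its group algebra *)

Section Dihedral.
Variables (C : comPzRingType) (n : nat).
Local Notation dih := (bool * 'Z_n)%type.

(* [(false, t)] stands for r^t and [(true, m)] for s r^m, where s r s = r^-1. *)
Definition dmul (x y : dih) : dih :=
  (x.1 (+) y.1, (if y.1 then - x.2 else x.2) + y.2).

Definition dinv (x : dih) : dih := if x.1 then x else (false, - x.2).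

Lemma dmulA : associative dmul.
Proof.
by move=> [a x] [b y] [c z]; rewrite /dmul addbA; case: b c => [] [] /=;
   congr (_, _); ring.
Qed.

Lemma dmul1 x : dmul (false, 0) x = x.
Proof. by case: x => -[] t; rewrite /dmul /= ?oppr0 add0r. Qed.

Lemma dmulV x : dmul (dinv x) x = (false, 0).
Proof. by case: x => -[] t; rewrite /dmul /= addNr. Qed.

Lemma dinvK : involutive dinv.
Proof. by case=> -[] t //; rewrite /dinv /= opprK. Qed.

Lemma dmulVK x : cancel (dmul x) (dmul (dinv x)).
Proof. by move=> y; rewrite dmulA dmulV dmul1. Qed.

Lemma dmulKV x : cancel (dmul (dinv x)) (dmul x).
Proof. by move=> y; rewrite -{1}(dinvK x) dmulVK. Qed.

Lemma dinvM x y : dinv (dmul x y) = dmul (dinv y) (dinv x).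
Proof.
by case: x y => -[] x [[] y]; rewrite /dmul /dinv /=; congr (_, _); ring.
Qed.

(** The product of the group algebra, on coefficients. *)
Definition dconv (F G : dih -> C) (x : dih) : C :=
  \sum_y F y * G (dmul (dinv y) x).

Lemma eq_dconv F F' G G' :
  F =1 F' -> G =1 G' -> dconv F G =1 dconv F' G'.
Proof. by move=> eF eG x; apply: eq_bigr => y _; rewrite eF eG. Qed.

Lemma dconvA F G H : dconv (dconv F G) H =1 dconv F (dconv G H).
Proof.
move=> x; rewrite /dconv.
under eq_bigr do rewrite mulr_suml.
rewrite exchange_big; apply: eq_bigr => y _.
rewrite (reindex_inj (can_inj (dmulVK y))) mulr_sumr; apply: eq_bigr => z _ /=.
by rewrite dmulVK dinvM -dmulA mulrA.
Qed.

(** [F] is a class function. Replacing y by y^-1 x in the sum for [dconv G F] evaluates it at x^-1 y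
    x, a conjugate of y. *)
Lemma dconv_comm F G :
  (forall x y, F (dmul (dinv y) (dmul x y)) = F x) -> dconv F G =1 dconv G F.
Proof.
move=> Fc x; rewrite /dconv.
rewrite [RHS](reindex_inj (_ : injective (fun y => dmul (dinv y) x))) /=.
  apply: eq_bigr => y _; rewrite mulrC; congr (_ * _).
  by rewrite dinvM dinvK -dmulA Fc.
apply: (can_inj (g := fun y => dmul x (dinv y))) => y.
by rewrite dinvM dinvK dmulKV.
Qed.

Lemma sum_dih (F : dih -> C) :
  \sum_y F y = \sum_(t : 'Z_n) F (false, t) + \sum_(m : 'Z_n) F (true, m).
Proof.
transitivity (\sum_b \sum_t F (b, t)); last by rewrite big_bool addrC.
by rewrite pair_bigA; apply: eq_bigr => -[].
Qed.

End Dihedral.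

(** * Convolution of functionals through their dihedral components *)

Section Convolution.
Variables (R : realType) (n : nat).
Hypothesis n_gt1 : (1 < n)%N.
Local Notation C := R[i].
Local Notation A := (CKP R n).
Local Notation etaX := (etaX R).

Lemma tensf_scalar (phi psi : {scalar A}) : scalar (tensf phi psi).
Proof.
move=> k x y; rewrite /tensf mulr_sumr -big_split; apply: eq_bigr => p _ /=.
by rewrite !ffunE mulrDl; congr (_ + _); exact: esym (mulrA _ _ _).
Qed.

HB.instance Definition _ (phi psi : {scalar A}) :=
  GRing.isLinear.Build C (CKP2 R n) C *%R (tensf phi psi) (tensf_scalar phi psi).

Lemma Delta_e_ (i j : 'Z_n) : Delta (e_ R i j) = Delta_e R i j.
Proof.
rewrite /Delta [X in _ + X]big1 ?addr0; last first.
  by move=> k _; apply: big1 => l _; rewrite mxE scale0r.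
rewrite pair_bigA (bigD1 (i, j)) //= big1 ?addr0.
  by rewrite ffunE eqxx scale1r.
by case=> k l /negPf kl; rewrite ffunE kl scale0r.
Qed.

Lemma Delta_E_ (i j : 'Z_n) : Delta (E_ R i j) = Delta_E R i j.
Proof.
rewrite /Delta [X in X + _]big1 ?add0r; last first.
  by move=> k _; apply: big1 => l _; rewrite ffunE scale0r.
rewrite pair_bigA (bigD1 (i, j)) //= big1 ?addr0.
  by rewrite mxE !eqxx scale1r.
case=> k l /negPf kl; rewrite mxE /= -[_ && _]/((k, l) == (i, j)).
by rewrite kl scale0r.
Qed.

Lemma conv_e (phi psi : {scalar A}) (i j : 'Z_n) :
  conv phi psi (e_ R i j) =
  \sum_s \sum_t phi (e_ R s t) * psi (e_ R (i - s) (j - t))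
  + n%:R^-1 * \sum_m \sum_r
      etaX (i * (m - r)) * (phi (E_ R m r) * psi (E_ R (m + j) (r + j))).
Proof.
rewrite /conv Delta_e_ linearD linearZ /=; congr (_ + _ * _).
  rewrite raddf_sum; apply: eq_bigr => s _.
  by rewrite raddf_sum; apply: eq_bigr => t _; apply: tensf_tens.
rewrite raddf_sum; apply: eq_bigr => s _.
rewrite raddf_sum; apply: eq_bigr => t _ /=.
by rewrite linearZ /= tensf_tens.
Qed.

Lemma conv_E (phi psi : {scalar A}) (i j : 'Z_n) :
  conv phi psi (E_ R i j) =
  \sum_s \sum_t etaX (s * (i - j)) *
     (phi (e_ R (- s) (- t)) * psi (E_ R (i - t) (j - t)))
  + \sum_s \sum_t etaX (s * (j - i)) *
     (phi (E_ R (i - t) (j - t)) * psi (e_ R s t)).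
Proof.
rewrite /conv Delta_E_ linearD /=.
congr (_ + _); rewrite raddf_sum; apply: eq_bigr => s _;
rewrite raddf_sum; apply: eq_bigr => t _ /=; by rewrite linearZ /= tensf_tens.
Qed.

Lemma eq_conv (phi phi' psi psi' : {scalar A}) :
  phi =1 phi' -> psi =1 psi' -> conv phi psi =1 conv phi' psi'.
Proof.
move=> e1 e2 x; rewrite /conv /tensf; apply: eq_bigr => p _.
by rewrite e1 e2.
Qed.

Lemma eq_on_basis (phi psi : {scalar A}) :
  (forall i j, phi (e_ R i j) = psi (e_ R i j)) ->
  (forall i j, phi (E_ R i j) = psi (E_ R i j)) -> phi =1 psi.
Proof.
move=> he hE x; rewrite (bas_decomp x) !raddf_sum; apply: eq_bigr => b _ /=.
by rewrite !linearZ; congr (_ * _); case: b => p; rewrite /= ?he ?hE.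
Qed.

(* The coefficients, in the group algebra of the dihedral group of order 2n,
   of the [d]-th component of [phi]. *)
Definition dihedral_coef (d : 'Z_n) (phi : {scalar A}) (x : bool * 'Z_n) : C :=
  if x.1 then phi (E_ R x.2 (x.2 - d))
  else \sum_s etaX (- (s * d)) * phi (e_ R s x.2).

(** The two sums in [Delta_e] account for the products of two rotations and of two reflections;
    those in [Delta_E] for a rotation times a reflection and a reflection times a rotation. *)
Lemma dihedral_coef_conv d (phi psi : {scalar A}) :
  dihedral_coef d (conv phi psi)
  =1 dconv (dihedral_coef d phi) (dihedral_coef d psi).
Proof.
have n0 : n%:R != 0 :> C by rewrite pnatr_eq0 -lt0n (ltn_trans _ n_gt1).
case=> -[] j; rewrite /dconv sum_dih /dihedral_coef /dmul /dinv /=.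
  rewrite conv_E; congr (_ + _).
    rewrite (reindex_inj oppr_inj) exchange_big (reindex_inj oppr_inj) /=.
    apply: eq_bigr => t _; rewrite mulr_suml; apply: eq_bigr => s _.
    rewrite !opprK mulrA addrC; congr (etaX _ * _ * psi (E_ R _ _)); ring.
  (* The reflection of index j - t times the rotation by t is the reflection of index j. *)
  rewrite exchange_big [RHS](reindex_inj (_ : injective (fun t => j - t))) /=.
    apply: eq_bigr => t _; rewrite mulr_sumr; apply: eq_bigr => s _.
    rewrite [RHS]mulrCA; congr (etaX _ * (phi (E_ R _ _) * psi (e_ R _ _))); ring.
  by move=> x y /addrI/oppr_inj.
under eq_bigr do rewrite conv_e mulrDr.
rewrite big_split /=; congr (_ + _).
  under eq_bigr do rewrite mulr_sumr.
  (* In the first index this is ordinary convolution on Z/n, which the Fourier transform makes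
     multiplicative. *)
  transitivity (\sum_s \sum_i \sum_t etaX (- ((i + s) * d)) *
      (phi (e_ R s t) * psi (e_ R i (j - t)))).
    rewrite exchange_big; apply: eq_bigr => s _.
    rewrite (reindex_inj (addIr s)) /=; apply: eq_bigr => i _.
    by rewrite mulr_sumr addrK.
  transitivity (\sum_s \sum_t \sum_i etaX (- ((i + s) * d)) *
      (phi (e_ R s t) * psi (e_ R i (j - t)))).
    by apply: eq_bigr => s _; rewrite exchange_big.
  rewrite exchange_big; apply: eq_bigr => t _.
  rewrite big_distrlr /=; apply: eq_bigr => s _; apply: eq_bigr => i _.
  have -> : - ((i + s) * d) = - (s * d) + - (i * d) by ring.
  by rewrite etaXD // mulrACA [- t + j]addrC.
(* By orthogonality the sum over i is n when m - r = d and 0 otherwise: it cancels the factor 1/n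
   and keeps only the matrix units of the d-th component. *)
transitivity (\sum_m \sum_r n%:R^-1 * (\sum_i etaX (i * (m - r - d))) *
   (phi (E_ R m r) * psi (E_ R (m + j) (r + j)))).
  under eq_bigr do rewrite !mulr_sumr.
  rewrite exchange_big; apply: eq_bigr => m _.
  under eq_bigr do rewrite !mulr_sumr.
  rewrite exchange_big; apply: eq_bigr => r _.
  rewrite mulr_sumr mulr_suml; apply: eq_bigr => i _.
  have -> : i * (m - r - d) = - (i * d) + i * (m - r) by ring.
  by rewrite etaXD //; ring.
apply: eq_bigr => m _; rewrite (bigD1 (m - d)) //= [X in _ + X]big1 ?addr0.
  rewrite sum_etaX // (_ : m - (m - d) - d = 0) ?eqxx; last by ring.
  rewrite mulVf // mul1r; congr (_ * psi (E_ R _ _)); ring.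
move=> r rmd; rewrite sum_etaX // ifF ?mulr0 ?mul0r //.
by apply: contraNF rmd => /eqP e; apply/eqP; rewrite -[LHS]addr0 -e; ring.
Qed.

(** Fourier inversion over d recovers the values at the [e_ R i j]; the value at [E_ R i j] is a
    coefficient of the component d = i - j. *)
Lemma dihedral_coef_inj (phi psi : {scalar A}) :
  (forall d, dihedral_coef d phi =1 dihedral_coef d psi) -> phi =1 psi.
Proof.
move=> e.
have n0 : n%:R != 0 :> C by rewrite pnatr_eq0 -lt0n (ltn_trans _ n_gt1).
have inv (f : {scalar A}) i j :
    n%:R * f (e_ R i j) = \sum_d etaX (i * d) * dihedral_coef d f (false, j).
  rewrite /dihedral_coef /=.
  under eq_bigr do rewrite mulr_sumr.
  rewrite exchange_big (bigD1 i) //= [X in _ + X]big1 ?addr0.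
    under eq_bigr do rewrite mulrA -etaXD // subrr etaX0 mul1r.
    have cZ : #|'Z_n| = n by rewrite card_ord Zp_cast.
    by rewrite sumr_const cZ mulr_natl.
  move=> s si; under eq_bigr do rewrite mulrA -etaXD // -mulrBl mulrC.
  rewrite -mulr_sumr; under eq_bigr do rewrite mulrC.
  by rewrite sum_etaX // subr_eq0 eq_sym (negPf si) mulr0.
apply: eq_on_basis => i j.
  by apply: (mulfI n0); rewrite !inv; apply: eq_bigr => d _; rewrite e.
by have := e (i - j) (true, i); rewrite /dihedral_coef /= subKr.
Qed.

Lemma conv_assoc (phi psi omega : {scalar A}) :
  conv (conv phi psi) omega =1 conv phi (conv psi omega).
Proof.
apply: dihedral_coef_inj => d x; rewrite !dihedral_coef_conv.
rewrite (eq_dconv (dihedral_coef_conv _ _ _) (frefl _)) dconvA.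
by apply: eq_dconv => // y; rewrite dihedral_coef_conv.
Qed.

(** The hypotheses make every component a class function: conjugation fixes or inverts a rotation,
    and moves the index of a reflection by an even amount. *)
Lemma conv_comm (phi psi : {scalar A}) :
  (forall i j, phi (e_ R i (- j)) = phi (e_ R i j)) ->
  (forall i j t, phi (E_ R (i + t *+ 2) (j + t *+ 2)) = phi (E_ R i j)) ->
  conv phi psi =1 conv psi phi.
Proof.
move=> he hE; apply: dihedral_coef_inj => d x; rewrite !dihedral_coef_conv.
apply: dconv_comm => -[b m] [c t]; rewrite /dihedral_coef /dmul /dinv /=.
case: b c => [] [] //=; rewrite ?addNr.
- rewrite -(hE m (m - d) (t - m)); congr (phi (E_ R _ _)); ring.
- rewrite -(hE m (m - d) t); congr (phi (E_ R _ _)); ring.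
- by apply: eq_bigr => s _; rewrite -he; congr (_ * phi (e_ R _ _)); ring.
- by apply: eq_bigr => s _; congr (_ * phi (e_ R _ _)); ring.
Qed.

End Convolution.

(** * Convolution preserves states *)

Section States.
Variables (R : realType) (n : nat).
Hypothesis n_gt1 : (1 < n)%N.
Local Notation C := R[i].
Local Notation A := (CKP R n).
Local Notation etaX := (etaX R).
Implicit Types phi psi : {scalar A}.

Lemma scalar_decomp phi (x : A) :
  phi x = \sum_i \sum_j x.1 (i, j) * phi (e_ R i j)
        + \sum_i \sum_j x.2 i j * phi (E_ R i j).
Proof.
rewrite {1}(bas_decomp x) raddf_sum big_sumType /=.
rewrite !pair_bigA /=; congr (_ + _);
by apply: eq_bigr => -[i j] _ /=; rewrite linearZ.
Qed.

Lemma scalar_star_mul phi (x : A) :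
  phi (star x * x) =
    \sum_i \sum_j (x.1 (i, j))^* * x.1 (i, j) * phi (e_ R i j)
  + \sum_k \sum_i \sum_j (x.2 k i)^* * x.2 k j * phi (E_ R i j).
Proof.
rewrite scalar_decomp; congr (_ + _).
  by apply: eq_bigr => i _; apply: eq_bigr => j _; rewrite !ffunE.
rewrite [RHS]exchange_big; apply: eq_bigr => i _.
rewrite [RHS]exchange_big; apply: eq_bigr => j _.
rewrite mxE mulr_suml; apply: eq_bigr => k _.
by rewrite !mxE.
Qed.

(** Positivity is tested on each summand of the algebra separately, and on the matrix summand row by
    row. *)
Lemma positiveP phi :
  (forall x : A, 0 <= phi (star x * x)) <->
  (forall i j, 0 <= phi (e_ R i j)) /\ psd (fun i j => phi (E_ R i j)).
Proof.
split=> [pos | [pos_e pos_E] x].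
  split=> [i j | c].
    have := pos (e_ R i j); congr (0 <= phi _); rewrite /star /e_.
    congr (_, _); last exact: mulmx0.
    by apply/ffunP => p; rewrite !ffunE conjC_nat -natrM mulnb andbb.
  (* With [c] as the only nonzero row, [star x * x] has entries [(c i)^* * c j]. *)
  have := pos (0, \matrix_(k, j) ((k == ord0)%:R * c j)).
  congr (0 <= _); rewrite scalar_star_mul /= big1 ?add0r; last first.
    by move=> i _; apply: big1 => j _; rewrite !ffunE mulr0 mul0r.
  rewrite (bigD1 ord0) //= [X in _ + X]big1 ?addr0; last first.
    move=> k /negPf k0; apply: big1 => i _; apply: big1 => j _.
    by rewrite !mxE k0 !mul0r mulr0 mul0r.
  by apply: eq_bigr => i _; apply: eq_bigr => j _; rewrite !mxE eqxx !mul1r.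
rewrite scalar_star_mul addr_ge0 //; last by apply: sumr_ge0 => k _; exact: pos_E.
apply: sumr_ge0 => i _; apply: sumr_ge0 => j _.
by rewrite mulr_ge0 // mulrC mul_conjC_ge0.
Qed.

(** The value at the unit is the augmentation of the component d = 0, and the augmentation of a
    group algebra is multiplicative. *)
Lemma scalar1 phi : phi 1 = \sum_x dihedral_coef 0 phi x.
Proof.
rewrite scalar_decomp sum_dih /dihedral_coef /=; congr (_ + _).
  rewrite exchange_big; apply: eq_bigr => j _; apply: eq_bigr => i _.
  by rewrite mulr0 oppr0 etaX0 ffunE.
apply: eq_bigr => i _; rewrite (bigD1 i) //= big1 ?addr0.
  by rewrite mxE eqxx mul1r subr0.
by move=> j /negPf ji; rewrite mxE eq_sym ji mul0r.
Qed.

Lemma conv1 phi psi : conv phi psi 1 = phi 1 * psi 1.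
Proof.
rewrite !scalar1; under eq_bigr do rewrite dihedral_coef_conv //.
rewrite /dconv exchange_big mulr_suml; apply: eq_bigr => y _.
rewrite mulr_sumr (reindex_inj (can_inj (dmulVK y))); apply: eq_bigr => x _ /=.
by rewrite dmulVK.
Qed.

Lemma is_state_conv phi psi :
  is_state phi -> is_state psi -> is_state (conv phi psi).
Proof.
move=> [/positiveP[phi_e phi_E] phi1] [/positiveP[psi_e psi_E] psi1].
split; last by rewrite /= conv1 phi1 psi1 mulr1.
apply/positiveP; split=> [i j | ].
  rewrite /= conv_e addr_ge0 //.
    by apply: sumr_ge0 => s _; apply: sumr_ge0 => t _; rewrite mulr_ge0.
  rewrite mulr_ge0 ?invr_ge0 ?ler0n //.
  (* The sum over matrix units is the form of a Schur product, taken at a vector of roots of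
     unity. *)
  have := psd_schur phi_E (psd_reindex (addIr j) psi_E).
  move=> /(_ (fun m => etaX (- (i * m)))); congr (0 <= _).
  apply: eq_bigr => m _; apply: eq_bigr => r _; congr (_ * _).
  by rewrite conj_etaX // opprK -etaXD // mulrBr.
(* The factor [etaX (s * (i - j))] is the rank one matrix u u^* with u_i = [etaX (s * i)]. *)
have psd_shift phi' (t : 'Z_n) (s : 'Z_n) : psd (fun i j => phi' (E_ R i j)) ->
    psd (fun i j => etaX (s * (i - j)) * phi' (E_ R (i - t) (j - t))).
  move=> phi'_E c.
  have := psd_rank1_mul (fun i => etaX (s * i)) (psd_reindex (addIr (- t)) phi'_E).
  move=> /(_ c); congr (0 <= _).
  apply: eq_bigr => i _; apply: eq_bigr => j _; congr (_ * (_ * _)).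
  by rewrite conj_etaX // -etaXD // mulrBr.
pose F1 s t i j := phi (e_ R (- s) (- t)) *
  (etaX (s * (i - j)) * psi (E_ R (i - t) (j - t))).
pose F2 s t i j := psi (e_ R s t) *
  (etaX (- s * (i - j)) * phi (E_ R (i - t) (j - t))).
move=> c; have : psd (fun i j => \sum_s \sum_t F1 s t i j + \sum_s \sum_t F2 s t i j).
  by apply: psdD; do 2![apply: psd_sum => ?]; apply: psdZ => //; apply: psd_shift.
move=> /(_ c); congr (0 <= _).
apply: eq_bigr => i _; apply: eq_bigr => j _; congr (_ * _).
rewrite /= conv_E; congr (_ + _); apply: eq_bigr => s _; apply: eq_bigr => t _.
  by rewrite /F1 mulrCA.
by rewrite /F2 mulNr -mulrN opprB mulrC mulrA.
Qed.

End States.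

(** * Characters give central functionals *)

Section Characters.
Variables (R : realType) (n : nat).
Hypothesis n_gt1 : (1 < n)%N.
Local Notation C := R[i].
Local Notation A := (CKP R n).
Local Notation etaX := (etaX R).

Lemma fourier_e (a : A) (i j : 'Z_n) :
  fourier a (e_ R i j) = (2 * n%:R ^+ 2)^-1 * a.1 (i, j).
Proof.
rewrite /fourier /haar; congr (_ * _).
rewrite [X in _ + _ * X]big1 ?mulr0 ?addr0; last first.
  by move=> k _; rewrite /= -[_ * _]/(0 *m a.2) mul0mx mxE.
rewrite pair_bigA (bigD1 (i, j)) //= big1 ?addr0.
  by rewrite !ffunE eqxx mul1r.
by case=> k l /negPf kl; rewrite !ffunE kl mul0r.
Qed.

(** The indices swap because the Haar state is a multiple of the trace on the matrix summand. *)
Lemma fourier_E (a : A) (i j : 'Z_n) :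
  fourier a (E_ R i j) = (2 * n%:R ^+ 2)^-1 * (n%:R * a.2 j i).
Proof.
rewrite /fourier /haar; congr (_ * _).
rewrite big1 ?add0r; last first.
  by move=> k _; apply: big1 => l _; rewrite !ffunE mul0r.
congr (_ * _).
rewrite (bigD1 i) //= [X in _ + X]big1 ?addr0; last first.
  by move=> k /negPf ki; rewrite mxE big1 // => l _; rewrite mxE ki mul0r.
rewrite mxE (bigD1 j) //= big1 ?addr0; first by rewrite mxE !eqxx mul1r.
by move=> l /negPf lj; rewrite mxE lj andbF mul0r.
Qed.

Lemma sum_e_coef (c : 'Z_n -> 'Z_n -> C) :
  \sum_i \sum_j c i j *: e_ R i j = ([ffun p => c p.1 p.2], 0) :> A.
Proof.
rewrite [LHS]surjective_pairing; congr (_, _).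
  apply/ffunP => -[k l]; rewrite pair_bigA raddf_sum sum_ffunE (bigD1 (k, l)) //=.
  rewrite big1 ?addr0 ?ffunE /= ?eqxx ?ffunE ?eqxx ?mulr1 //.
    by rewrite [LHS]mulr1.
  by case=> i j /negPf ij; rewrite !ffunE eq_sym ij [LHS]mulr0.
rewrite raddf_sum; apply: big1 => i _; rewrite raddf_sum; apply: big1 => j _.
by rewrite /= scaler0.
Qed.

Lemma sum_E_coef (c : 'Z_n -> C) (l : 'Z_n) :
  \sum_m c m *: E_ R m (m + l) =
  (0, \matrix_(i, j) (c i * (j == i + l)%:R)) :> A.
Proof.
rewrite [LHS]surjective_pairing; congr (_, _).
  by rewrite raddf_sum; apply: big1 => i _; rewrite /= scaler0.
apply/matrixP => i j; rewrite raddf_sum summxE (bigD1 i) //= big1 ?addr0.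
  by rewrite !mxE eqxx.
by move=> k /negPf ki; rewrite !mxE eq_sym ki mulr0.
Qed.

(** Reduction modulo an even n preserves parity. *)
Lemma signZD (x y : 'Z_n) : ~~ odd n ->
  (-1) ^+ (x + y)%R = (-1) ^+ x * (-1) ^+ y :> C.
Proof.
move=> n_even; have odd_modZ k : odd (k %% (Zp_trunc n).+2) = odd k.
  by rewrite Zp_cast // odd_mod //; exact: negPf.
by rewrite -exprD -[LHS]signr_odd odd_modZ signr_odd.
Qed.

Lemma signZN (x : 'Z_n) : ~~ odd n -> (-1) ^+ (- x)%R = (-1) ^+ x :> C.
Proof.
move=> n_even; have := signZD x (- x) n_even; rewrite subrr expr0 => e.
by apply: (can_inj (signrMK x)); rewrite -e -expr2 sqrr_sign.
Qed.

(** Through roots of unity, replacing t by its opposite in ['Z_n], whose representative is n - t for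
    nonzero t, becomes complex conjugation. *)
Lemma cos_etaX (t : 'Z_n) (v : nat) :
  (cos (2 * (t : nat)%:R * v%:R * pi / n%:R))%:C%C
  = (etaX t ^+ v + (etaX t ^+ v)^*) / 2 :> C.
Proof.
have e : etaX t ^+ v = eta R n ^+ (t * v)%N by rewrite /Defs.etaX exprM.
rewrite e eta_exp natrM.
have -> : 2 * (t : nat)%:R * v%:R * pi / n%:R
  = (t : nat)%:R * v%:R * (2 * pi / n%:R) :> R by ring.
set x := _ * (2 * pi / _).
apply: (mulIf (_ : 2 != 0)); rewrite ?pnatr_eq0 // divfK ?pnatr_eq0 //.
apply/eqP; rewrite eq_complex /=; apply/andP; split; apply/eqP; ring.
Qed.

Lemma cosZN (t : 'Z_n) (v : nat) :
  (cos (2 * (- t : 'Z_n)%:R * v%:R * pi / n%:R))%:C%C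
  = (cos (2 * (t : nat)%:R * v%:R * pi / n%:R))%:C%C :> C.
Proof.
by rewrite !cos_etaX -conj_etaX // -rmorphXn /= conjCK addrC.
Qed.

(* These two invariances say that the functional [fourier a] restricts to a
   class function on each dihedral component. *)
Definition central_coefs (a : A) : Prop :=
  (forall i j, a.1 (i, - j) = a.1 (i, j)) /\
  (forall i j t, a.2 (i + t *+ 2) (j + t *+ 2) = a.2 i j).

(** For rho the coefficients do not depend on j and the matrix is invariant under all diagonal
    shifts. For X the cosine is even and the matrix part is zero. For sigma the sign is even in j,
    and a shift by 2t multiplies it by a square of a sign. *)
Lemma chi_central (alpha : irr n) : central_coefs (chi R alpha).
Proof.
case: alpha => [b l | u v | n_even b l] /=.
- rewrite sum_e_coef.
  under [X in _ + _ *: X]eq_bigr do rewrite -[E_ _ _ _]scale1r.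
  rewrite sum_E_coef; split=> [i j | i j t] /=.
    by rewrite !ffunE /=.
  by rewrite !mxE [i + _ + l]addrAC (inj_eq (addIr _)).
- rewrite sum_e_coef; split=> [i j | i j t]; last by rewrite !mxE.
  rewrite !ffunE; congr (2 *: (_ * _)); exact: cosZN.
- rewrite sum_e_coef sum_E_coef; split=> [i j | i j t] /=.
    by rewrite !ffunE /= signZN.
  rewrite !mxE [i + _ + l]addrAC (inj_eq (addIr _)) !add0r.
  by rewrite mulr2n !signZD // -expr2 sqrr_sign mulr1.
Qed.

Lemma central_coefs_sum (a_ : irr n -> C) :
  central_coefs (\sum_alpha a_ alpha *: chi R alpha).
Proof.
split=> [i j | i j t].
  rewrite !raddf_sum !sum_ffunE; apply: eq_bigr => alpha _.
  by rewrite !ffunE (proj1 (chi_central alpha)).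
rewrite !raddf_sum !summxE; apply: eq_bigr => alpha _.
by rewrite !mxE (proj2 (chi_central alpha)).
Qed.

Lemma fourier_central (a : A) (psi : {scalar A}) :
  central_coefs a -> conv (fourier a) psi =1 conv psi (fourier a).
Proof.
move=> [He HE]; apply: (conv_comm n_gt1) => [i j | i j t].
  exact: etrans (fourier_e _ _ _)
    (etrans (congr1 _ (He _ _)) (esym (fourier_e _ _ _))).
apply: etrans (fourier_E _ _ _) _; apply: etrans (esym (fourier_E _ _ _)).
by rewrite HE.
Qed.

End Characters.

(** * Limits of convolution powers *)

(** The order may be partial, as on complex numbers; continuity of the norm gives that l equals its
    own norm. *)
Lemma limn_ge0 (K : numFieldType) (u : nat -> K^o) (l : K) :
  (forall k, 0 <= u k) -> (u @ \oo --> (l : K^o))%classic -> 0 <= l.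
Proof.
move=> u0 ul; have norm_ul := cvg_norm ul _.
rewrite (_ : (fun k => `|u k|) = u) in norm_ul; last first.
  by apply/funext => k; rewrite ger0_norm.
by rewrite (cvg_unique (@norm_hausdorff K K^o) ul (norm_ul _)).
Qed.

Section Powers.
Variables (R : realType) (n : nat).
Hypothesis n_gt1 : (1 < n)%N.
Local Notation C := R[i].
Local Notation A := (CKP R n).
Implicit Types phi psi mu : {scalar A}.

Lemma is_state_convpowS phi k : is_state phi -> is_state (convpowS phi k).
Proof. by move=> hphi; elim: k => //= k IH; apply: is_state_conv. Qed.

Lemma convpowS_central phi k : (forall psi, conv phi psi =1 conv psi phi) ->
  forall psi, conv (convpowS phi k) psi =1 conv psi (convpowS phi k).
Proof.
move=> hphi; elim: k => //= k IH psi x.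
rewrite conv_assoc // (eq_conv (frefl _) (hphi psi)).
rewrite -(conv_assoc n_gt1 (convpowS phi k)).
by rewrite (eq_conv (IH psi) (frefl phi)) conv_assoc.
Qed.

Lemma conv_convpowS mu phi k : conv mu phi =1 mu ->
  conv mu (convpowS phi k) =1 mu.
Proof.
move=> hmu; elim: k => //= k IH x.
by rewrite -conv_assoc // (eq_conv IH (frefl phi)).
Qed.

Lemma dual_cvg_unique (f : nat -> {scalar A}) phi psi :
  dual_cvg f phi -> dual_cvg f psi -> phi =1 psi.
Proof.
move=> hphi hpsi x; apply: (cvg_unique _ (hphi x) (hpsi x)).
exact: norm_hausdorff.
Qed.

Lemma dual_cvg_cst phi : dual_cvg (fun=> phi) phi.
Proof. by move=> x; apply: cvg_cst. Qed.

Lemma eq_dual_cvg (f g : nat -> {scalar A}) mu :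
  (forall k, f k =1 g k) -> dual_cvg f mu -> dual_cvg g mu.
Proof.
move=> fg hf x; rewrite -(_ : (fun k => f k x : C^o) = (fun k => g k x : C^o)) //.
by apply/funext => k; rewrite fg.
Qed.

(** At each x, a convolution is a finite sum of products of values at basis elements. *)
Lemma dual_cvg_conv (f g : nat -> {scalar A}) phi psi :
  dual_cvg f phi -> dual_cvg g psi ->
  dual_cvg (fun k => conv (f k) (g k)) (conv phi psi).
Proof.
move=> hf hg x; rewrite /= /conv /tensf.
apply: cvg_big => [| p _]; first exact: add_continuous.
apply: (cvgM (K := C)); first exact: cvg_cst.
by apply: (cvgM (K := C)).
Qed.

Lemma dual_cvg_state (f : nat -> {scalar A}) mu :
  (forall k, is_state (f k)) -> dual_cvg f mu -> is_state mu.
Proof.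
move=> hf hmu; split=> [x | ].
  by apply: (limn_ge0 _ (hmu (star x * x))) => k; have [+ _] := hf k.
apply: (cvg_unique (@norm_hausdorff C C^o) (hmu 1)).
rewrite (_ : (fun k => f k 1 : C^o) = fun=> 1); first exact: cvg_cst.
by apply/funext => k; have [_] := hf k.
Qed.

Lemma limit_central_idempotent phi mu :
  is_state phi -> (forall psi, conv phi psi =1 conv psi phi) ->
  dual_cvg (convpowS phi) mu -> central_idempotent_state mu.
Proof.
move=> hphi phiC hmu.
have mu_phi : conv mu phi =1 mu.
  (* Convolving the powers with [phi] only shifts the sequence by one, so the limit is unchanged. *)
  have hl := dual_cvg_conv hmu (dual_cvg_cst (phi := phi)).
  suff hr : dual_cvg (fun k => conv (convpowS phi k) phi) mu.
    exact: dual_cvg_unique hl hr.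
  move=> x.
  by have := hmu x; rewrite -(cvg_shiftS (fun k => convpowS phi k x : C^o)).
split; first exact: dual_cvg_state (fun k => is_state_convpowS k hphi) hmu.
  (* The sequence of mu convolved with the powers is constantly mu, and it tends to mu convolved
     with itself. *)
  have hl := dual_cvg_conv (dual_cvg_cst (phi := mu)) hmu.
  apply: (dual_cvg_unique hl).
  apply: eq_dual_cvg (dual_cvg_cst (phi := mu)) => k x.
  by rewrite /= conv_convpowS.
move=> psi; apply: (dual_cvg_unique (dual_cvg_conv hmu (dual_cvg_cst (phi := psi)))).
apply: eq_dual_cvg (dual_cvg_conv (dual_cvg_cst (phi := psi)) hmu) => k x.
by rewrite /= convpowS_central.
Qed.

End Powers.

Theorem proposition3p1 (R : realType) (n : nat) (hn : (2 <= n)%N)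
    (a_ : irr n -> R[i]) (a : CKP R n)
    (ha : a = \sum_(alpha : irr n) a_ alpha *: chi R alpha)
    (hstate : is_state (fourier a))
    (mu : {scalar CKP R n})
    (hcvg : dual_cvg (convpowS (fourier a)) mu) :
  central_idempotent_state mu.
Proof.
apply: (limit_central_idempotent hn hstate _ hcvg) => psi.
by apply: (fourier_central hn); rewrite ha; exact: central_coefs_sum.
Qed.
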